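(* Let $p\neq 0$ be real, $\Delta=\sqrt{p^2+4}$, $\tau=(p+\Delta)/2$, $\sigma=(p-\Delta)/2$. Let $W_0,W_1$ be real numbers and let $(W_j)_{j\in\mathbb Z}$ be the sequence with $W_j=pW_{j-1}+W_{j-2}$ for all integers $j$. Put $A=\frac{W_1-W_0\sigma}{\tau-\sigma}$, $B=\frac{W_0\tau-W_1}{\tau-\sigma}$, and define the complex-valued function $w(x)=A\tau^x+B\sigma^x$ for $x\in\mathbb R$. Then for every integer $j$, $$\Re\left(\left.\frac{d}{dx}w(x)\right|_{x=j}\right)=\frac{W_{j+1}+W_{j-1}}{\Delta}\ln\tau .$$
   Context: Since $\sigma<0$, the power $\sigma^x$ is understood as $e^{x\log\sigma}$ with a fixed logarithm $\log\sigma=\ln|\sigma|+i\pi(2m+1)$ (e.g. the principal one, $m=0$); $\tau^x=e^{x\ln\tau}$ with $\tau>0$. One has $w(j)=W_j$ for integers $j$. $\Re$ denotes the real part. *)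

(* Defs.v *)
From Stdlib Require Import Reals ZArith.
From Coquelicot Require Import Coquelicot.
Open Scope R_scope.

Definition Delta_of (p : R) : R := sqrt (p ^ 2 + 4).
Definition tau_of (p : R) : R := (p + Delta_of p) / 2.
Definition sigma_of (p : R) : R := (p - Delta_of p) / 2.

Definition coefA (p W0 W1 : R) : R := (W1 - W0 * sigma_of p) / (tau_of p - sigma_of p).
Definition coefB (p W0 W1 : R) : R := (W0 * tau_of p - W1) / (tau_of p - sigma_of p).

Definition Cexp (z : C) : C := (exp (Re z) * cos (Im z), exp (Re z) * sin (Im z)).

(* The branches, indexed by [m], of the logarithm of a negative real [s];
   [m = 0] is the principal one. *)
Definition log_neg (m : Z) (s : R) : C := (ln (Rabs s), PI * (2 * IZR m + 1)).

(* [Rpower t x] is [exp (x * ln t)]. *)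
Definition w_of (p W0 W1 : R) (m : Z) (x : R) : C :=
  (RtoC (coefA p W0 W1) * RtoC (Rpower (tau_of p) x)
   + RtoC (coefB p W0 W1) * Cexp (RtoC x * log_neg m (sigma_of p)))%C.

(* Main.v *)
Require Import Defs.
From Stdlib Require Import Reals ZArith Lra Lia.
From Coquelicot Require Import Coquelicot.
Open Scope R_scope.

(* Write [L = ln tau]. As [tau sigma = -1], [ln |sigma| = - L], so at an integer
   [j] the real part of the derivative is [L (A tau^j - B sigma^j)]: the term
   carrying the argument [PI (2 m + 1)] has the factor [sin (j PI (2 m + 1)) = 0].
   By Binet's formula [W (j+1) + W (j-1) = A tau^j (tau - sigma) +
   B sigma^j (sigma - tau)], and [tau - sigma = Delta]. *)

(** The pair is [f t] times [(1, 0)] plus [g t] times [(0, 1)], so the rules for sums and for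
    scaling a fixed vector give its derivative. *)
Lemma is_derive_C (f g : R -> R) (x df dg : R) :
  is_derive f x df -> is_derive g x dg ->
  is_derive (K := R_AbsRing) (V := C_R_NormedModule)
    (fun t => (f t, g t) : C) x (df, dg).
Proof.
  intros Hf Hg.
  pose proof (is_derive_plus (K := R_AbsRing) (V := C_R_NormedModule) _ _ x _ _
    (is_derive_scal_l (V := C_R_NormedModule) f x df (1, 0) Hf)
    (is_derive_scal_l (V := C_R_NormedModule) g x dg (0, 1) Hg)) as H.
  replace (df, dg) with
    (plus (scal df ((1, 0) : C_R_NormedModule)) (scal dg ((0, 1) : C_R_NormedModule))).
  - refine (is_derive_ext _ _ _ _ _ H); intros t.
    apply injective_projections; cbn; ring.
  - apply injective_projections; cbn; ring.
Qed.

(** Induction in both directions on two consecutive values. Going down works because [u (j - 1)] has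
    coefficient 1, so the recurrence can be solved for it. *)
Lemma Z_recurrence_unique (p : R) (u v : Z -> R) :
  (forall j, u (j + 1)%Z = p * u j + u (j - 1)%Z) ->
  (forall j, v (j + 1)%Z = p * v j + v (j - 1)%Z) ->
  u 0%Z = v 0%Z -> u 1%Z = v 1%Z -> forall j, u j = v j.
Proof.
  intros Hu Hv H0 H1 j.
  enough (H : u j = v j /\ u (j + 1)%Z = v (j + 1)%Z) by apply H.
  induction j as [| j [IH IH'] | j [IH IH']] using Z.peano_ind; [easy | |].
  - rewrite <- Z.add_1_r; split; [easy |].
    rewrite Hu, Hv, Z.add_simpl_r; congruence.
  - rewrite <- Z.sub_1_r, Z.sub_add; split; [| easy].
    specialize (Hu j); specialize (Hv j); rewrite IH, IH' in Hu; lra.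
Qed.

Lemma Delta_sqr (p : R) : Delta_of p * Delta_of p = p ^ 2 + 4.
Proof. apply sqrt_sqrt; nra. Qed.

Lemma Delta_gt (p : R) : Rabs p < Delta_of p.
Proof.
  rewrite <- sqrt_Rsqr_abs; apply sqrt_lt_1; unfold Rsqr; nra.
Qed.

Lemma tau_pos (p : R) : 0 < tau_of p.
Proof.
  pose proof (Delta_gt p) as H; apply Rabs_def2 in H; unfold tau_of; lra.
Qed.

Lemma sigma_neg (p : R) : sigma_of p < 0.
Proof.
  pose proof (Delta_gt p) as H; apply Rabs_def2 in H; unfold sigma_of; lra.
Qed.

Lemma tau_mul_sigma (p : R) : tau_of p * sigma_of p = -1.
Proof. pose proof (Delta_sqr p); unfold tau_of, sigma_of; nra. Qed.

Lemma tau_sub_sigma (p : R) : tau_of p - sigma_of p = Delta_of p.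
Proof. unfold tau_of, sigma_of; field. Qed.

Lemma ln_abs_sigma (p : R) : ln (Rabs (sigma_of p)) = - ln (tau_of p).
Proof.
  pose proof (tau_pos p).
  rewrite <- ln_Rinv, Rabs_left by auto using sigma_neg; f_equal.
  apply Rmult_eq_reg_l with (tau_of p); [| lra].
  rewrite Rinv_r by lra; pose proof (tau_mul_sigma p); lra.
Qed.

Lemma cos_odd_PI (m : Z) : cos (PI * (2 * IZR m + 1)) = -1.
Proof.
  replace (PI * (2 * IZR m + 1)) with (2 * (IZR m * PI) + PI) by ring.
  rewrite neg_cos, cos_2a_sin, sin_eq_0_1 by (now exists m); ring.
Qed.

(** Used with [j = 1] for the unit shift of [sigma_pow], and with general [j] to kill the
    branch-dependent term of the derivative. *)
Lemma sin_odd_PI (m j : Z) : sin (IZR j * (PI * (2 * IZR m + 1))) = 0.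
Proof.
  apply sin_eq_0_1; exists (j * (2 * m + 1))%Z.
  rewrite mult_IZR, plus_IZR, mult_IZR; ring.
Qed.

Definition tau_pow (p : R) (x : R) : R := exp (x * ln (tau_of p)).

(* The real part of [sigma ^ x] for the branch [m] of the logarithm. *)
Definition sigma_pow (p : R) (m : Z) (x : R) : R :=
  exp (x * ln (Rabs (sigma_of p))) * cos (x * (PI * (2 * IZR m + 1))).

Lemma tau_pow_add1 (p x : R) : tau_pow p (x + 1) = tau_of p * tau_pow p x.
Proof.
  unfold tau_pow; rewrite Rmult_plus_distr_r, exp_plus, Rmult_1_l, exp_ln.
  - ring.
  - apply tau_pos.
Qed.

(** Valid at every real [x]: shifting the angle by an odd multiple of [PI] flips the sign of the
    cosine, and [- Rabs (sigma_of p)] is [sigma_of p]. *)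
Lemma sigma_pow_add1 (p : R) (m : Z) (x : R) :
  sigma_pow p m (x + 1) = sigma_of p * sigma_pow p m x.
Proof.
  pose proof (sigma_neg p); unfold sigma_pow.
  rewrite !Rmult_plus_distr_r, exp_plus, !Rmult_1_l, exp_ln, cos_plus
    by (apply Rabs_pos_lt; lra).
  pose proof (sin_odd_PI m 1) as Hs; rewrite Rmult_1_l in Hs.
  rewrite Hs, cos_odd_PI, Rabs_left by assumption; ring.
Qed.

(** The factor is [/ tau_of p], written as [- sigma_of p] to keep later identities free of
    inverses. *)
Lemma tau_pow_sub1 (p x : R) : tau_pow p (x - 1) = - sigma_of p * tau_pow p x.
Proof.
  replace (tau_pow p x) with (tau_pow p (x - 1 + 1)) by (f_equal; ring).
  rewrite tau_pow_add1.
  replace (- sigma_of p * (tau_of p * tau_pow p (x - 1)))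
    with (- (tau_of p * sigma_of p) * tau_pow p (x - 1)) by ring.
  rewrite tau_mul_sigma; ring.
Qed.

Lemma sigma_pow_sub1 (p : R) (m : Z) (x : R) :
  sigma_pow p m (x - 1) = - tau_of p * sigma_pow p m x.
Proof.
  replace (sigma_pow p m x) with (sigma_pow p m (x - 1 + 1)) by (f_equal; ring).
  rewrite sigma_pow_add1.
  replace (- tau_of p * (sigma_of p * sigma_pow p m (x - 1)))
    with (- (tau_of p * sigma_of p) * sigma_pow p m (x - 1)) by ring.
  rewrite tau_mul_sigma; ring.
Qed.

Lemma Binet (p : R) (W : Z -> R) (m : Z) :
  (forall j : Z, W j = p * W (j - 1)%Z + W (j - 2)%Z) ->
  forall j : Z, W j = coefA p (W 0%Z) (W 1%Z) * tau_pow p (IZR j)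
                    + coefB p (W 0%Z) (W 1%Z) * sigma_pow p m (IZR j).
Proof.
  intros hW.
  assert (HD : tau_of p - sigma_of p <> 0)
    by (pose proof (tau_pos p); pose proof (sigma_neg p); lra).
  assert (Ht0 : tau_pow p 0 = 1) by (unfold tau_pow; now rewrite Rmult_0_l, exp_0).
  assert (Hs0 : sigma_pow p m 0 = 1)
    by (unfold sigma_pow; rewrite !Rmult_0_l, exp_0, cos_0; ring).
  apply (Z_recurrence_unique p).
  - intros j; rewrite hW, Z.add_simpl_r; do 2 f_equal; lia.
  - intros j; rewrite plus_IZR, minus_IZR.
    rewrite tau_pow_add1, sigma_pow_add1, tau_pow_sub1, sigma_pow_sub1.
    (* With the shifts expressed through both roots, the recurrence reduces to [tau = p - sigma] and
       [sigma = p - tau], that is, to the sum of the roots. *)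
    assert (Hp : p = tau_of p + sigma_of p) by (unfold tau_of, sigma_of; field).
    ring [Hp].
  - rewrite Ht0, Hs0; unfold coefA, coefB; field; exact HD.
  (* The value at 1 is reached from the value at 0 by one unit shift. *)
  - replace (IZR 1) with (0 + 1) by ring.
    rewrite tau_pow_add1, sigma_pow_add1, Ht0, Hs0.
    unfold coefA, coefB; field; exact HD.
Qed.

Theorem theorem1 (p : R) (hp : p <> 0) (W : Z -> R)
    (hW : forall j : Z, W j = p * W (j - 1)%Z + W (j - 2)%Z) (m j : Z) :
  exists l : C,
    is_derive (K := R_AbsRing) (V := C_R_NormedModule)
      (w_of p (W 0%Z) (W 1%Z) m) (IZR j) l /\
    Re l = (W (j + 1)%Z + W (j - 1)%Z) / Delta_of p * ln (tau_of p).
Proof.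
  set (A := coefA p (W 0%Z) (W 1%Z)); set (B := coefB p (W 0%Z) (W 1%Z)).
  set (L := ln (tau_of p)); set (M := ln (Rabs (sigma_of p))).
  set (th := PI * (2 * IZR m + 1)).
  (* The derivative stays open here and is fixed by [auto_derive] on the real and imaginary
     parts. *)
  eexists; split.
  - apply (is_derive_ext (V := C_R_NormedModule)
      (fun x => (A * exp (x * L) + B * (exp (x * M) * cos (x * th)),
                 B * (exp (x * M) * sin (x * th))) : C)).
    + intros x; unfold w_of, Cexp, log_neg, Rpower.
      fold A B L M th.
      apply injective_projections; cbn;
        replace (x * M - 0 * th) with (x * M) by ring;
        replace (x * th + 0 * M) with (x * th) by ring; ring.
    + apply is_derive_C; auto_derive; reflexivity.
  - cbn [Re fst].
    rewrite (Binet p W m hW (j + 1)), (Binet p W m hW (j - 1)).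
    rewrite plus_IZR, minus_IZR.
    rewrite tau_pow_add1, sigma_pow_add1, tau_pow_sub1, sigma_pow_sub1.
    (* With [Delta] as [tau - sigma], the right side has the numerator
       [(tau - sigma) * (A tau^j - B sigma^j)], so the denominator cancels; it is nonzero because
       the roots have opposite signs. *)
    rewrite <- tau_sub_sigma.
    unfold tau_pow, sigma_pow.
    fold A B L M th.
    pose proof (sin_odd_PI m j : sin (IZR j * th) = 0) as Hsin; rewrite Hsin.
    replace M with (- L) by (symmetry; apply ln_abs_sigma).
    pose proof (tau_pos p); pose proof (sigma_neg p).
    field; lra.
Qed.
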